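(* If an adaptive adversary controls either (i) the contexts, or (ii) the budget, then for any base algorithm $\mathbb A$ used in the Greedy Reduction, there exists a contextual multi-armed bandit problem with two contexts and two arms such that $\mathbb E[\mathrm{Reg}(T)]\ge \frac T4$, even if $\mathbb E[B(t)]=\frac t2$ for all $t\in\{1,\dots,T\}$.
   Context: Contextual multi-armed bandit with reward queries (unit query costs) and horizon $T\in\mathbb N$. At each round $t$ a context $u_t$ (here from a set of two contexts) and a budget $B(t)$ are revealed, where the budget sequence is non-negative and non-decreasing. The agent plays an arm $a_t$ (here from a set of two arms), and a reward $R_t\in[0,1]$ with conditional mean $r(u_t,a_t)$ is generated. The agent also chooses $q_t\in\{0,1\}$ and observes $R_t$ only if $q_t=1$, which is allowed only if $\sum_{k<t}q_k\le B(t)-1$. The regret is $\mathrm{Reg}(T)=\sum_{t=1}^T\big(\max_a r(u_t,a)-r(u_t,a_t)\big)$. An adaptive adversary is one whose choices (of the contexts, respectively of the budget) may depend on the history of the interaction; when it controls the contexts it may also react to the current budget, and when it controls the budget it may also react to the current context. For a base algorithm $\mathbb A$ for the unbudgeted problem, $\mathbb A_j(u)$ denotes the arm it outputs at its $j$-th iteration when the input context is $u$. Greedy Reduction. Required input: an algorithm $\mathbb A$ and an initial budget $B(1)\ge1$. Initialize $l=0$. For $t=1,\dots,T$: observe the context $u_t$ and the current budget $B(t)$. If $B(t)\ge\sum_{k<t}q_k+1$, set $l\leftarrow l+1$, play $a_t=\mathbb A_l(u_t)$ with $q_t=1$, and observe $R_t$, which serves as the feedback of the $l$-th iteration of $\mathbb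 A$. Otherwise, sample $j$ uniformly from $\{1,\dots,l\}$ and play $a_t=\mathbb A_j(u_t)$ with $q_t=0$.
   Formalization: The requirement B(1) ≥ 1 of the Greedy Reduction is dropped, since it contradicts E[B(1)] = 1/2; when no query has yet been possible (l = 0), the arm is drawn by an arbitrary fallback rule, and the result holds for every such rule. *)

(* Defs.v *)
From HB Require Import structures.
From mathcomp Require Import all_boot all_order all_algebra.
From mathcomp Require Import all_classical all_reals all_analysis.

Set Implicit Arguments.
Unset Strict Implicit.
Unset Printing Implicit Defensive.

Import Order.TTheory GRing.Theory Num.Theory.
Import numFieldNormedType.Exports.

Local Open Scope classical_set_scope.
Local Open Scope ring_scope.

Definition is_pmf (R : realType) (I : finType) (p : I -> R) : Prop :=
  (forall i, 0 <= p i) /\ \sum_i p i = 1.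

Section Model.
Variables (R : realType) (U K : finType).

(* U is the set of contexts and K the set of arms *)
Record bandit := Bandit {
  reward_law : U -> K -> probability (measurableTypeR R) R;
  mean_reward : U -> K -> R;
  reward_law01 : forall u a, reward_law u a `[0, 1]%classic = 1%E;
  reward_law_mean : forall u a,
    (\int[reward_law u a]_x x%:E = (mean_reward u a)%:E)%E }.

(* A round is recorded as ((u_t, a_t, q_t), (B(t), R_t)). The discrete and the
   real components are grouped so that a history of length n with a fixed
   discrete part s is [zip s z] with z in the measurable space
   n.-tuple (R * R); this is how measurability is expressed below. *)
Definition round : Type := (U * K * bool) * (R * R).
Definition context_of (d : round) : U := d.1.1.1.
Definition arm_of (d : round) : K := d.1.1.2.
Definition query_of (d : round) : bool := d.1.2.
Definition budget_of (d : round) : R := d.2.1.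
Definition reward_of (d : round) : R := d.2.2.

Definition history : Type := seq round.

Definition queries (h : history) : nat := count query_of h.

(* The mean rewards lie in [0, 1], so that 0 is neutral for the maximum. *)
Definition regret (pb : bandit) (h : history) : R :=
  \sum_(d <- h) (\big[Num.max/0]_(a : K) mean_reward pb (context_of d) a
                 - mean_reward pb (context_of d) (arm_of d)).

(* B(t) read off a complete history; rounds are numbered from 1. *)
Definition budget_at (t : nat) (h : history) : R :=
  nth 0 (map budget_of h) t.-1.

Definition policy : Type := {ffun U -> K}.

(* One entry per completed iteration of the base algorithm: the context fed to
   it, the realized map u |-> A_j(u), and the reward fed back. *)
Definition memory : Type := seq ((U * policy) * R).

(* A randomized base algorithm, given by the conditional law of the map A_j
   knowing the first j - 1 iterations. Since the past maps are part of the
   memory, any internal randomization, possibly correlated across iterations,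
   is allowed. *)
Record base_algorithm := BaseAlgorithm {
  base_law :> memory -> policy -> R;
  base_law_pmf : forall m, is_pmf (base_law m);
  base_law_measurable : forall n (s : n.-tuple (U * policy)) (A : policy),
    measurable_fun [set: n.-tuple (measurableTypeR R)]
      (fun x : n.-tuple (measurableTypeR R) => base_law (zip s x) A) }.

(* The law of the arm played when no query has been possible so far, in which
   case there is no past iteration to sample from. It may depend on the past
   contexts and arms and on the current context. *)
Record fallback_rule := FallbackRule {
  fallback_law :> seq (U * K) -> U -> K -> R;
  fallback_law_pmf : forall s u, is_pmf (fallback_law s u) }.

(* How a round is generated from the history: u_t has law [context_law h], and
   then B(t) = [budget_rule h u_t]. *)
Record environment := Environment {
  context_law : history -> U -> R;
  budget_rule : history -> U -> R }.

Section Interaction.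
Local Open Scope ereal_scope.

(* One round of the Greedy Reduction. [G a q upd] is the expected continuation
   value when arm a is played with query bit q and the memory becomes [upd x]
   upon the reward x. *)
Definition greedy_round (alg : base_algorithm) (fb : fallback_rule)
    (h : history) (m : memory) (u : U) (b : R)
    (G : K -> bool -> (R -> memory) -> \bar R) : \bar R :=
  if ((queries h)%:R + 1 <= b)%R then
    \sum_(A : policy) (alg m A)%:E *
      G (A u) true (fun x => rcons m ((u, A), x))
  else if m is [::] then
    \sum_(a : K) (fb [seq (context_of d, arm_of d) | d <- h] u a)%:E *
      G a false (fun=> m)
  else
    \sum_(e <- m) ((size m)%:R^-1)%:E * G (e.1.2 u) false (fun=> m).

(* The expectation of F (final history) over the n rounds following (h, m). *)
Fixpoint expectation_from (pb : bandit) (env : environment)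
    (alg : base_algorithm) (fb : fallback_rule) (F : history -> R)
    (n : nat) (h : history) (m : memory) : \bar R :=
  if n is n'.+1 then
    \sum_(u : U) (context_law env h u)%:E *
      (let b := budget_rule env h u in
       greedy_round alg fb h m u b (fun a q upd =>
         \int[reward_law pb u a]_x
           expectation_from pb env alg fb F n'
             (rcons h ((u, a, q), (b, x))) (upd x)))
  else (F h)%:E.

Definition expectation_run pb env alg fb F (T : nat) : \bar R :=
  expectation_from pb env alg fb F T [::] [::].

End Interaction.

(* A budget sequence drawn independently of the interaction. Only
   [budget_path w t] with t >= 1 is used, as B(t). *)
Record oblivious_budget d (Om : measurableType d) := ObliviousBudget {
  budget_prob : probability Om R;
  budget_path : Om -> nat -> R;
  budget_path_measurable : forall t,
    measurable_fun [set: Om] (fun w => budget_path w t : measurableTypeR R);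
  budget_path_ge0 : forall w t, 0 <= budget_path w t;
  budget_path_nondecreasing : forall w t,
    budget_path w t <= budget_path w t.+1 }.

(* u_t as a function of the history before round t and of B(t). *)
Record context_adversary := ContextAdversary {
  adversary_context :> history -> R -> U;
  adversary_context_measurable : forall n (s : n.-tuple (U * K * bool)) (u : U),
    measurable_fun
      [set: (n.-tuple (measurableTypeR R * measurableTypeR R)
             * measurableTypeR R)%type]
      (fun z => adversary_context (zip s z.1) z.2 == u) }.

Definition context_adversary_env (b : nat -> R) (adv : context_adversary) :
    environment :=
  {| context_law := fun h u => (adv h (b (size h).+1) == u)%:R;
     budget_rule := fun h _ => b (size h).+1 |}.

Definition expectation_context_adversary d (Om : measurableType d)
    (pb : bandit) (ob : oblivious_budget Om) (adv : context_adversary)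
    (alg : base_algorithm) (fb : fallback_rule) (F : history -> R) (T : nat) :
    \bar R :=
  (\int[budget_prob ob]_w
     expectation_run pb (context_adversary_env (budget_path ob w) adv)
       alg fb F T)%E.

(* B(t) as a function of the history before round t and of u_t. With the
   convention B(0) = 0, the last condition says that budgets are non-negative
   and non-decreasing. *)
Record budget_adversary := BudgetAdversary {
  adversary_budget :> history -> U -> R;
  adversary_budget_measurable : forall n (s : n.-tuple (U * K * bool)) (u : U),
    measurable_fun
      [set: n.-tuple (measurableTypeR R * measurableTypeR R)%type]
      (fun z => adversary_budget (zip s z) u : measurableTypeR R);
  adversary_budget_nondecreasing : forall h u,
    last 0 (map budget_of h) <= adversary_budget h u }.

(* The contexts are i.i.d. with law D. *)
Definition budget_adversary_env (D : U -> R) (adv : budget_adversary) :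
    environment :=
  {| context_law := fun _ => D; budget_rule := adv |}.

Definition expectation_budget_adversary
    (pb : bandit) (D : U -> R) (adv : budget_adversary)
    (alg : base_algorithm) (fb : fallback_rule) (F : history -> R) (T : nat) :
    \bar R :=
  expectation_run pb (budget_adversary_env D adv) alg fb F T.

End Model.

(* Main.v *)
(** Two deterministic problems P_i (i = 0, 1): context 0 always pays 0, and
    context 1 pays 1 exactly when arm i is played. If queries are possible only
    on context 0, the base algorithm receives the same feedback under P_0 and
    P_1, so both problems induce the same law on contexts, arms and queries;
    since each visit to context 1 costs regret 1 in exactly one of the two, the
    two expected regrets add up to the expected number of visits to context 1,
    and one of them is at least half of it.

    With B(t) = t / 2, queries become possible exactly at even t, and the
    context adversary shows context 0 at even and context 1 at odd rounds. With
    uniform i.i.d. contexts, the budget adversary raises the budget by one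
    exactly on context 0, so that B(t) is the number of visits to context 0 and
    E[B(t)] = t / 2. Either way context 1 is visited at least T / 2 times on
    average. *)

Require Import Defs.
From HB Require Import structures.
From mathcomp Require Import all_boot all_order all_algebra.
From mathcomp Require Import all_classical all_reals all_analysis measurable_realfun.
From mathcomp Require Import zify lra.

Import Order.TTheory GRing.Theory Num.Theory.

Local Open Scope ring_scope.

(** * Integration against a Dirac mass *)

Section IntegralDirac.
Local Open Scope classical_set_scope.
Local Open Scope ereal_scope.
Context d (T : measurableType d) (R : realType) (a : T).
Hypothesis ma : measurable [set a].

Import HBNNSimple.

(* Unlike [integral_dirac], no measurability of [f] is needed: the supremum
   over simple functions is reached at a multiple of the indicator of [a]. *)
Lemma ge0_integral_dirac_fin (f : T -> \bar R) :
  (forall x, 0 <= f x) -> f a \is a fin_num ->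
  \int[\d_a]_x f x = f a.
Proof.
move=> f0 fa.
have sintE (h : {nnsfun T >-> R}) : sintegral (\d_a) h = (h a)%:E.
  rewrite -integralT_nnsfun integral_dirac ?diracT ?mul1e//.
  exact/measurable_EFinP.
rewrite ge0_integralTE//; apply/eqP; rewrite eq_le; apply/andP; split.
  by apply: ge_ereal_sup => _ [h hf <-]; rewrite sintE hf.
have r0 : (0 <= fine (f a))%R by rewrite fine_ge0.
apply: ereal_sup_ubound.
exists (scale_nnsfun (indic_nnsfun R ma) r0) => [x|]; last first.
  by rewrite sintE /= mindicE mem_set// mulr1 fineK.
rewrite /= mindicE; have [xa|xa] := pselect (x = a).
  by rewrite xa mem_set// mulr1 fineK.
by rewrite memNset// mulr0.
Qed.

Lemma integral_dirac_fin (f : T -> \bar R) :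
  f a \is a fin_num -> \int[\d_a]_x f x = f a.
Proof.
move=> fa; rewrite integralE !ge0_integral_dirac_fin//.
- by rewrite [in RHS](funeposneg f).
- by rewrite funenegE; case: leP => // _; rewrite fin_numN.
- by rewrite funeposE; case: leP.
Qed.

End IntegralDirac.

(** * Bandits with deterministic rewards *)

Section DiracBandit.
Context {R : realType} {U K : finType} {rho : U -> K -> R}.
Hypothesis rho01 : forall u a, rho u a \in `[0, 1].

Definition dirac_law (u : U) (a : K) : probability (measurableTypeR R) R :=
  \d_(rho u a : measurableTypeR R).

Lemma integral_dirac_law (u : U) (a : K) (f : R -> \bar R) :
  f (rho u a) \is a fin_num ->
  (\int[dirac_law u a]_x f x)%E = f (rho u a).
Proof.
by move=> fin; apply: integral_dirac_fin => //; exact: measurable_set1.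
Qed.

Lemma dirac_law01 (u : U) (a : K) : dirac_law u a `[0, 1]%classic = 1%E.
Proof. by rewrite /dirac_law /= diracE mem_set//; exact: rho01. Qed.

Lemma dirac_law_mean (u : U) (a : K) :
  (\int[dirac_law u a]_x x%:E = (rho u a)%:E)%E.
Proof. by rewrite integral_dirac_law. Qed.

Definition dirac_bandit : bandit R U K := Bandit dirac_law01 dirac_law_mean.

End DiracBandit.

(* A finite sum of extended reals has finite terms, so this shape of hypothesis
   also carries finiteness through the induction below. *)
Lemma sum_coupled (R : realType) (I : Type) (s : seq I) (p v : I -> R)
    (X0 X1 : I -> \bar R) :
  (forall i, (p i != 0)%R -> X0 i + X1 i = (v i)%:E)%E ->
  (\sum_(i <- s) (p i)%:E * X0 i + \sum_(i <- s) (p i)%:E * X1 i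
   = (\sum_(i <- s) p i * v i)%:E)%E.
Proof.
move=> X01; rewrite -big_split/= -sumEFin; apply: eq_bigr => i _.
have [->|/X01 Xv] := eqVneq (p i) 0; first by rewrite !mul0e mul0r adde0.
have [fX0 fX1] : X0 i \is a fin_num /\ X1 i \is a fin_num.
  by apply/andP; rewrite -fin_numD Xv.
by rewrite EFinM -Xv muleDr// fin_num_adde_defl.
Qed.

(** * Coupling of two runs that differ only in their rewards *)

Section Coupling.
Context {R : realType} {U K : finType}.
Implicit Types h : history R U K.

(* Coupled histories differ only in the realized rewards. *)
Definition erase_rewards h := [seq (d.1, budget_of d) | d <- h].

Definition reward_blind {A : Type} (f : history R U K -> A) : Prop :=
  forall h h', erase_rewards h = erase_rewards h' -> f h = f h'.

Lemma reward_blind_map {A : Type} (g : (U * K * bool) * R -> A) :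
  reward_blind (fun h => [seq g (d.1, budget_of d) | d <- h]).
Proof.
move=> h h' hh'.
have E k : [seq g (d.1, budget_of d) | d <- k] = map g (erase_rewards k).
  by rewrite /erase_rewards -map_comp.
by rewrite !E hh'.
Qed.

Lemma reward_blind_queries : reward_blind (@queries R U K).
Proof.
move=> h h' hh'; have E := reward_blind_map (fun d => d.1.2) _ _ hh'.
by rewrite /queries -!(count_map (@query_of R U K) id) /query_of E.
Qed.

Lemma reward_blind_size : reward_blind (@size (round R U K)).
Proof.
by move=> h h' /(congr1 size); rewrite !size_map.
Qed.

Lemma reward_blind_budgets : reward_blind (map (@budget_of R U K)).
Proof. exact: (reward_blind_map snd). Qed.

(* In [G01], the disjunction says that the memory is updated with the reward
   only on a query. *)
Lemma greedy_round_coupled (alg : base_algorithm R U K)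
    (fb : fallback_rule R U K) (h h' : history R U K) (m : memory R U K)
    (u : U) (b v : R) (G0 G1 : K -> bool -> (R -> memory R U K) -> \bar R) :
  erase_rewards h = erase_rewards h' ->
  (forall a q upd, q = ((queries h)%:R + 1 <= b)%R ->
     q \/ (forall x y, upd x = upd y) ->
     G0 a q upd + G1 a q upd = v%:E)%E ->
  (greedy_round alg fb h m u b G0 + greedy_round alg fb h' m u b G1 = v%:E)%E.
Proof.
move=> hh' G01; rewrite /greedy_round -(reward_blind_queries _ _ hh').
have -> : [seq (context_of d, arm_of d) | d <- h'] =
          [seq (context_of d, arm_of d) | d <- h].
  by apply/esym; exact: (reward_blind_map (fun d => (d.1.1.1, d.1.1.2))).
case: ifPn => q.
  rewrite (sum_coupled _ _ _ _ (fun=> v)) => [|A _]; last by apply: G01; auto.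
  by rewrite -mulr_suml (base_law_pmf alg m).2 mul1r.
case: m => [|e m].
  rewrite (sum_coupled _ _ _ _ (fun=> v)) => [|A _].
    by rewrite -mulr_suml (fallback_law_pmf fb _ u).2 mul1r.
  by apply: G01; [rewrite (negbTE q)|right].
rewrite (sum_coupled _ _ _ _ (fun=> v)) => [|A _].
  rewrite big_const_seq count_predT iter_addr_0 -[_ *+ size _]mulr_natl mulrA divff ?mul1r//.
  by rewrite pnatr_eq0.
by apply: G01; [rewrite (negbTE q)|right].
Qed.

Context (rho0 rho1 : U -> K -> R).
Hypothesis rho0_01 : forall u a, rho0 u a \in `[0, 1].
Hypothesis rho1_01 : forall u a, rho1 u a \in `[0, 1].
Context (env : environment R U K).
Hypothesis context_law_blind : reward_blind (context_law env).
Hypothesis budget_rule_blind : reward_blind (budget_rule env).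
Context (F0 F1 : history R U K -> R).
Hypothesis F1_blind : reward_blind F1.
Context (P : nat -> history R U K -> Prop) (c : nat -> history R U K -> R).
Hypothesis final : forall h, P 0 h -> F0 h + F1 h = c 0 h.
Hypothesis step : forall n h, P n.+1 h ->
  exists2 v : U -> R, \sum_u context_law env h u * v u = c n.+1 h &
    forall u, context_law env h u != 0 ->
      let b := budget_rule env h u in
      let q := (queries h)%:R + 1 <= b in
      (q -> rho0 u =1 rho1 u) /\
      (forall a x, let h' := rcons h ((u, a, q), (b, x)) in
        P n h' /\ c n h' = v u).

(** [P] is an invariant with [n] rounds to go and, by [step], [c] is a martingale whose next value
    depends on the new round only through its context. Induction on [n] works because both runs
    share the memory [m], hence the law of the arm. *)
Lemma expectation_from_coupled (alg : base_algorithm R U K)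
    (fb : fallback_rule R U K) (n : nat) (h h' : history R U K)
    (m : memory R U K) :
  P n h -> erase_rewards h = erase_rewards h' ->
  (expectation_from (dirac_bandit rho0_01) env alg fb F0 n h m +
   expectation_from (dirac_bandit rho1_01) env alg fb F1 n h' m
   = (c n h)%:E)%E.
Proof.
elim: n h h' m => [|n IH] h h' m Ph hh' /=.
  by rewrite -(F1_blind _ _ hh') -EFinD final.
have [v <- hv] := step _ _ Ph.
rewrite -(context_law_blind _ _ hh') -(budget_rule_blind _ _ hh').
apply: sum_coupled => u /hv/= [rhoE Pc].
apply: greedy_round_coupled => // a q upd qE updE.
pose E0 x := expectation_from (dirac_bandit rho0_01) env alg fb F0 n
  (rcons h ((u, a, q), (budget_rule env h u, x))) (upd x).
pose E1 x := expectation_from (dirac_bandit rho1_01) env alg fb F1 n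
  (rcons h' ((u, a, q), (budget_rule env h u, x))) (upd x).
rewrite -/(E0 _) -/(E1 _).
have E01 : (E0 (rho0 u a) + E1 (rho1 u a) = (v u)%:E)%E.
  have [Ph' <-] := Pc a (rho0 u a).
  (* On a query the two rewards agree by [rhoE]; without one [upd] ignores its argument. Either way
     both runs keep the same memory. *)
  rewrite /E1 (_ : upd (rho1 u a) = upd (rho0 u a)); last first.
    by case: updE => [|updE]; [rewrite qE => /rhoE ->|exact: updE].
  rewrite -qE in Ph' *.
  by apply: IH => //; rewrite /erase_rewards !map_rcons -/(erase_rewards _) hh'.
have [fE0 fE1] : E0 (rho0 u a) \is a fin_num /\ E1 (rho1 u a) \is a fin_num.
  by apply/andP; rewrite -fin_numD E01.
by rewrite !integral_dirac_law.
Qed.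

End Coupling.

Lemma split_sum_bound (R : realType) (x y : \bar R) (c r : R) :
  (x + y = c%:E)%E -> r *+ 2 <= c -> (r%:E <= x)%E \/ (r%:E <= y)%E.
Proof.
move=> xy rc; have [fx fy] : x \is a fin_num /\ y \is a fin_num.
  by apply/andP; rewrite -fin_numD xy.
move: xy; rewrite -(fineK fx) -(fineK fy) -EFinD !lee_fin => -[xy].
by have [|lt] := leP r (fine x); [left|right; lra].
Qed.

(** Turns the coupling of a problem with itself into the value of an expectation. *)
Lemma eq_double (R : realType) (x : \bar R) (c : R) :
  (x + x = (c *+ 2)%:E)%E -> x = c%:E.
Proof.
move=> xx; have /andP[fx _] : (x \is a fin_num) && (x \is a fin_num).
  by rewrite -fin_numD xx.
by move: xx; rewrite -(fineK fx) -EFinD => -[xx]; congr EFin; lra.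
Qed.

(** * The problems P_0 and P_1 and their regrets *)

Section TwoProblems.
Variable R : realType.
Implicit Types h : history R 'I_2 'I_2.

Definition target_reward (i u a : 'I_2) : R := ((u == ord_max) && (a == i))%:R.

Lemma target_reward01 (i u a : 'I_2) : target_reward i u a \in `[0, 1].
Proof. by rewrite /target_reward in_itv/= ler0n lern1 leq_b1. Qed.

Definition target_bandit (i : 'I_2) := dirac_bandit (target_reward01 i).

Lemma regret_targetE (i : 'I_2) h :
  regret (target_bandit i) h =
  \sum_(d <- h) ((context_of d == ord_max) && (arm_of d != i))%:R.
Proof.
rewrite /regret; apply: eq_bigr => d _; rewrite /= /target_reward.
case: (_ == ord_max) => /=; last by rewrite !big_ord_recl big_ord0 !maxxx subr0.
rewrite (_ : \big[_/_]_a _ = 1); first by case: (_ == i); rewrite ?subrr ?subr0.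
apply/eqP; rewrite eq_le (bigmax_sup i) ?eqxx// andbT.
by apply/bigmax_leP; split => // a _; rewrite lern1 leq_b1.
Qed.

Definition regret_sum h : R :=
  regret (target_bandit ord0) h + regret (target_bandit ord_max) h.

(** With two arms, [a] misses exactly one of the two targets, so the increment does not depend on
    it. *)
Lemma regret_sum_rcons h (u a : 'I_2) (q : bool) (bx : R * R) :
  regret_sum (rcons h ((u, a, q), bx)) = regret_sum h + (u == ord_max)%:R.
Proof.
rewrite /regret_sum !regret_targetE !big_rcons/= /context_of /arm_of/=.
rewrite addrACA -natrD; congr (_ + _%:R).
by case: (_ == ord_max) => //; case: a => -[|[|]].
Qed.

Lemma regret_blind (i : 'I_2) : reward_blind (regret (target_bandit i)).
Proof.
move=> h h' hh'; rewrite !regret_targetE.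
have E k : \sum_(d <- k) ((context_of d == ord_max) && (arm_of d != i))%:R =
    \sum_(b <- [seq (d.1.1.1 == ord_max) && (d.1.1.2 != i) | d <- k]) b%:R :> R.
  by rewrite big_map.
rewrite !E; congr bigop.
exact: (reward_blind_map (fun d => (d.1.1.1 == ord_max) && (d.1.1.2 != i))).
Qed.

Lemma budget_at_blind (t : nat) : reward_blind (@budget_at R 'I_2 'I_2 t).
Proof. by move=> h h' hh'; rewrite /budget_at (reward_blind_budgets _ _ hh'). Qed.


(** * Adversarial contexts *)

Section AlternatingContexts.

(** [size h] counts the past rounds, so an odd size means that an even-numbered round is about to
    start. *)
Definition alternating_context (h : history R 'I_2 'I_2) (b : R) : 'I_2 :=
  if odd (size h) then ord0 else ord_max.

Lemma alternating_context_measurable n (s : n.-tuple ('I_2 * 'I_2 * bool))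
    (u : 'I_2) :
  measurable_fun
    [set: (n.-tuple (measurableTypeR R * measurableTypeR R)
           * measurableTypeR R)%type]
    (fun z => alternating_context (zip s z.1) z.2 == u).
Proof.
rewrite (_ : (fun z => _) = fun=> (if odd n then ord0 else ord_max) == u).
  exact: measurable_cst.
by apply/funext => z; rewrite /alternating_context size_zip !size_tuple minnn.
Qed.

Definition alternating_adversary : context_adversary R 'I_2 'I_2 :=
  ContextAdversary alternating_context_measurable.

Definition half_budget : oblivious_budget R (measurableTypeR R).
Proof.
refine (@ObliviousBudget R _ (measurableTypeR R)
  (\d_(0 : measurableTypeR R)) (fun _ t => t%:R / 2) _ _ _).
- by move=> t; exact: measurable_cst.
- by move=> _ t; rewrite divr_ge0.
- by move=> _ t; rewrite ler_pM2r ?ler_nat// invr_gt0.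
Defined.

Let env := context_adversary_env (fun t => t%:R / 2) alternating_adversary.

Lemma expectation_half_budget pb alg fb F T :
  expectation_context_adversary pb half_budget alternating_adversary alg fb F T
  = expectation_run pb env alg fb F T.
Proof.
rewrite -[RHS]mule1 -(probability_setT (budget_prob half_budget)).
by rewrite -integral_cst.
Qed.

(** Invariant of the run: one query per completed pair of rounds, and the prescribed budgets. *)
Definition half_budget_history (h : history R 'I_2 'I_2) : Prop :=
  queries h = (size h)./2 /\
  map (@budget_of R 'I_2 'I_2) h = [seq t%:R / 2 | t <- iota 1 (size h)].

(** With [n] rounds over and [n./2] queries spent, the test at round [n.+1] amounts to
    [n./2 * 2 + 2 <= n.+1], which fails exactly for even [n]. *)
Lemma half_budget_query (n : nat) :
  ((n./2)%:R + 1 <= n.+1%:R / 2 :> R) = odd n.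
Proof.
by rewrite ler_pdivlMr// natr1 -natrM ler_nat; lia.
Qed.

Lemma half_budget_history_rcons h (u a : 'I_2) (x : R) :
  half_budget_history h ->
  half_budget_history
    (rcons h ((u, a, (queries h)%:R + 1 <= (size h).+1%:R / 2 :> R),
              ((size h).+1%:R / 2, x))).
Proof.
move=> [qh bh]; split.
  rewrite /queries -cats1 count_cat -/(queries h) qh/= /query_of/= addn0.
  by rewrite half_budget_query size_cat addn1/= uphalf_half addnC.
by rewrite map_rcons bh size_rcons -(addn1 (size h)) iotaD map_cat cats1 addnC.
Qed.

(** The context is a function of the history, so [c] itself has to be conserved along the run.
    Queries fall on context 0, where every target pays 0, so [i] and [j] are arbitrary. *)
Lemma alternating_coupled (i j : 'I_2) (F0 F1 : history R 'I_2 'I_2 -> R)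
    (c : history R 'I_2 'I_2 -> R) alg fb T :
  reward_blind F1 ->
  (forall h, size h = T -> half_budget_history h -> F0 h + F1 h = c h) ->
  (forall h a q bx, (size h < T)%N ->
     c (rcons h ((if odd (size h) then ord0 else ord_max, a, q), bx)) = c h) ->
  (expectation_run (target_bandit i) env alg fb F0 T +
   expectation_run (target_bandit j) env alg fb F1 T = (c [::])%:E)%E.
Proof.
move=> F1b F01 cE.
apply: (@expectation_from_coupled _ _ _ _ _ _ _ env _ _ F0 F1 _
  (fun n h => (size h + n)%N = T /\ half_budget_history h) (fun _ => c)) => //.
- by move=> h h' hh'; apply/funext => u /=; rewrite /alternating_context
    (reward_blind_size _ _ hh').
- by move=> h h' hh'; apply/funext => u /=; rewrite (reward_blind_size _ _ hh').
- by move=> h [hT Hh]; apply: F01 => //; rewrite -hT addn0.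
move=> n h [hT Hh]; exists (fun=> c h).
  rewrite -mulr_suml /= (bigD1 (alternating_context h ((size h).+1%:R / 2)))//=.
  rewrite eqxx big1 ?addr0 ?mul1r// => u /negbTE.
  by rewrite eq_sym => ->.
move=> u /=; rewrite pnatr_eq0 eqb0 negbK => /eqP uE; split.
  rewrite Hh.1 half_budget_query => odd_h a.
  by rewrite -uE /alternating_context odd_h.
move=> a x; split; first split.
- by rewrite size_rcons addSnnS.
- exact: half_budget_history_rcons.
- by rewrite -uE cE// -hT -addSnnS leq_addr.
Qed.

Lemma alternating_budget i alg fb (T t : nat) : (1 <= t <= T)%N ->
  expectation_run (target_bandit i) env alg fb (@budget_at R 'I_2 'I_2 t) T
  = (t%:R / 2)%:E.
Proof.
move=> /andP[t1 tT]; apply: eq_double.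
apply: (alternating_coupled _ _ _ _ (fun=> (t%:R / 2) *+ 2)) => //.
  exact: budget_at_blind.
move=> h hT [_ bh]; rewrite -mulr2n /budget_at bh.
by rewrite (nth_map 0%N) ?nth_iota ?size_iota ?hT ?add1n ?prednK.
Qed.

Lemma sum_even_rounds T : (\sum_(0 <= k < T) ~~ odd k = uphalf T)%N.
Proof.
elim: T => [|T IH]; first by rewrite big_nil.
by rewrite big_nat_recr//= IH; lia.
Qed.

Lemma alternating_regret alg fb T :
  exists i, ((T%:R / 4)%:E <= expectation_run (target_bandit i) env alg fb
    (regret (target_bandit i)) T)%E.
Proof.
(* Summed regret so far plus the number of context 1 rounds still to come; each such round moves one
   unit from the second term to the first. *)
pose c h := regret_sum h + (\sum_(size h <= k < T) ~~ odd k)%:R.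
have /split_sum_bound : (expectation_run (target_bandit ord0) env alg fb
      (regret (target_bandit ord0)) T
    + expectation_run (target_bandit ord_max) env alg fb
      (regret (target_bandit ord_max)) T = (c [::])%:E)%E.
  apply: alternating_coupled; first exact: regret_blind.
    by move=> h hT _; rewrite /c hT big_geq// addr0.
  move=> h a q bx hT; rewrite /c regret_sum_rcons size_rcons.
  rewrite [in RHS]big_ltn// natrD addrA; congr (_ + _%:R + _).
  by case: odd.
case/(_ (T%:R / 4)) => [|le|le]; last 2 first.
- by exists ord0.
- by exists ord_max.
rewrite /c /regret_sum !regret_targetE !big_nil !add0r sum_even_rounds.
have : (T%:R <= (uphalf T * 2)%:R :> R) by rewrite ler_nat; lia.
by rewrite natrM; lra.
Qed.

End AlternatingContexts.

(** * Adversarial budget *)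

Section MatchingBudget.

Definition last_budget h : R := last 0 (map (@budget_of R 'I_2 'I_2) h).

Definition matching_budget h (u : 'I_2) : R := last_budget h + (u == ord0)%:R.

Lemma matching_budget_measurable n (s : n.-tuple ('I_2 * 'I_2 * bool))
    (u : 'I_2) :
  measurable_fun
    [set: n.-tuple (measurableTypeR R * measurableTypeR R)%type]
    (fun z => matching_budget (zip s z) u : measurableTypeR R).
Proof.
apply: measurable_funD; last exact: measurable_cst.
have budgetE (z : n.-tuple (measurableTypeR R * measurableTypeR R)%type) :
    map (@budget_of R 'I_2 'I_2) (zip s z) = map fst z.
  rewrite -[in RHS](@unzip2_zip _ _ s z) ?size_tuple// /unzip2 -map_comp.
  exact: eq_map.
(* On an empty history the last budget is the default 0; otherwise it is read off the last
   coordinate by measurable projections. *)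
case: n s budgetE => [|n] s budgetE.
  rewrite (_ : (fun z => _) = cst 0); first exact: measurable_cst.
  by apply/funext => z; rewrite /last_budget budgetE tuple0.
rewrite (_ : (fun z => _) = fst \o (fun z => tnth z ord_max)).
  by apply: measurableT_comp; [exact: measurable_fst|exact: measurable_tnth].
apply/funext => z; rewrite /last_budget budgetE /= (tnth_nth (0, 0)).
by rewrite (last_nth 0) size_map size_tuple/= -(nth_map _ 0) ?size_tuple.
Qed.

Lemma matching_budget_nondecreasing h (u : 'I_2) :
  last_budget h <= matching_budget h u.
Proof. by rewrite lerDl. Qed.

Definition matching_adversary : budget_adversary R 'I_2 'I_2 :=
  BudgetAdversary matching_budget_measurable matching_budget_nondecreasing.

Definition fair_context (u : 'I_2) : R := 2^-1.

Lemma sum_fair_context (v : 'I_2 -> R) :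
  \sum_u fair_context u * v u = (v ord0 + v ord_max) / 2.
Proof.
rewrite !big_ord_recl big_ord0 addr0 -mulrDr mulrC; congr ((_ + v _) / _).
exact: val_inj.
Qed.

Lemma fair_context_pmf : is_pmf fair_context.
Proof.
split=> [u|]; first by rewrite invr_ge0.
have := sum_fair_context (fun=> 1); under eq_bigr do rewrite mulr1.
by move=> ->; lra.
Qed.

Let env := budget_adversary_env fair_context matching_adversary.

Lemma last_budget_blind : reward_blind last_budget.
Proof.
by move=> h h' hh'; rewrite /last_budget (reward_blind_budgets _ _ hh').
Qed.

(** Budget and query count stay equal, so a query is affordable exactly on context 0, where every
    target pays 0. The condition on [v] says that [c] is its mean over the two equally likely
    contexts. *)
Lemma matching_coupled (i j : 'I_2) (F0 F1 : history R 'I_2 'I_2 -> R)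
    (c : history R 'I_2 'I_2 -> R) alg fb T :
  reward_blind F1 ->
  (forall h, size h = T -> F0 h + F1 h = c h) ->
  (forall h, (size h < T)%N -> exists2 v : 'I_2 -> R,
     v ord0 + v ord_max = c h *+ 2 &
     forall u a q x,
       c (rcons h ((u, a, q), (last_budget h + (u == ord0)%:R, x))) = v u) ->
  (expectation_run (target_bandit i) env alg fb F0 T +
   expectation_run (target_bandit j) env alg fb F1 T = (c [::])%:E)%E.
Proof.
move=> F1b F01 cE.
apply: (@expectation_from_coupled _ _ _ _ _ _ _ env _ _ F0 F1 _
  (fun n h => (size h + n)%N = T /\ last_budget h = (queries h)%:R)
  (fun _ => c)) => //.
- by move=> h h' hh'; apply/funext => u /=; rewrite /matching_budget
    (last_budget_blind _ _ hh').
- by move=> h [hT _]; apply: F01; rewrite -hT addn0.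
move=> n h [hT bh].
have [|v vE cv] := cE h; first by rewrite -hT -addSnnS leq_addr.
have queryE (u : 'I_2) :
    ((queries h)%:R + 1 <= matching_budget h u) = (u == ord0).
  by rewrite /matching_budget bh lerD2l ler1n lt0b.
exists v; first by rewrite sum_fair_context vE; lra.
move=> u _ /=; split.
  by rewrite queryE => /eqP -> a; rewrite /target_reward.
move=> a x; split; last exact: cv.
split; first by rewrite size_rcons addSnnS.
rewrite queryE /last_budget map_rcons last_rcons /budget_of/=.
by rewrite /matching_budget bh /queries -cats1 count_cat/= addn0 natrD.
Qed.

Lemma matching_budget_mean i alg fb (T t : nat) : (1 <= t <= T)%N ->
  expectation_run (target_bandit i) env alg fb (@budget_at R 'I_2 'I_2 t) T
  = (t%:R / 2)%:E.
Proof.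
move=> /andP[t1 tT]; apply: eq_double.
(* Conditional mean of B(t) given [h]: its realized value once round [t] is over, otherwise the
   current budget plus one half per round up to [t]. *)
pose c h : R := if (t <= size h)%N then budget_at t h
  else last_budget h + (t%:R - (size h)%:R) / 2.
have -> : (t%:R / 2) *+ 2 = c [::] *+ 2.
  by rewrite /c leqNgt t1 /= subr0 /last_budget add0r.
apply: (matching_coupled _ _ _ _ (fun h => c h *+ 2)).
- exact: budget_at_blind.
- by move=> h hT; rewrite /c hT tT.
move=> h hT.
(* Until round [t] is over, [c] moves by the budget increment minus its mean; afterwards it is
   frozen. *)
exists (fun u => (if (t <= size h)%N then c h
  else c h + ((u == ord0)%:R - 2^-1)) *+ 2).
  by case: ifP => _ /=; lra.
move=> u a q x; congr (_ *+ 2); rewrite /c size_rcons /budget_at map_rcons.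
rewrite nth_rcons size_map.
have [th|ht] := leqP t (size h).
  by rewrite (leqW th) prednK ?th.
rewrite /last_budget map_rcons last_rcons /budget_of/=.
(* If the new round is round [t] itself, [c] switches to the recorded budget, and the half unit left
   in [c h] cancels the subtracted mean. *)
have [th|th] := leqP t (size h).+1.
  have -> : t = (size h).+1 by lia.
  by rewrite ltnn eqxx -natr1; lra.
by rewrite -natr1; lra.
Qed.

Lemma matching_regret alg fb T :
  exists i, ((T%:R / 4)%:E <= expectation_run (target_bandit i) env alg fb
    (regret (target_bandit i)) T)%E.
Proof.
(* Summed regret so far plus the expected number of visits to context 1 still to come. *)
pose c h := regret_sum h + (T%:R - (size h)%:R) / 2.
have /split_sum_bound : (expectation_run (target_bandit ord0) env alg fb
      (regret (target_bandit ord0)) T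
    + expectation_run (target_bandit ord_max) env alg fb
      (regret (target_bandit ord_max)) T = (c [::])%:E)%E.
  apply: matching_coupled; first exact: regret_blind.
    by move=> h hT; rewrite /c hT subrr mul0r addr0.
  move=> h hT; exists (fun u => c h + ((u == ord_max)%:R - 2^-1)).
    by rewrite /=; lra.
  by move=> u a q x; rewrite /c regret_sum_rcons size_rcons -natr1; lra.
case/(_ (T%:R / 4)) => [|le|le]; last 2 first.
- by exists ord0.
- by exists ord_max.
by rewrite /c /regret_sum !regret_targetE !big_nil !add0r subr0; lra.
Qed.

End MatchingBudget.

End TwoProblems.

Theorem proposition6 (R : realType) (T : nat)
    (alg : base_algorithm R 'I_2 'I_2) (fb : fallback_rule R 'I_2 'I_2) :
  (exists (pb : bandit R 'I_2 'I_2)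
          (d : measure_display) (Om : measurableType d)
          (ob : oblivious_budget R Om) (adv : context_adversary R 'I_2 'I_2),
      (forall t : nat, (1 <= t <= T)%N ->
         expectation_context_adversary pb ob adv alg fb
           (@budget_at R 'I_2 'I_2 t) T = (t%:R / 2)%:E) /\
      ((T%:R / 4)%:E <=
         expectation_context_adversary pb ob adv alg fb (regret pb) T)%E)
  /\
  (exists (pb : bandit R 'I_2 'I_2)
          (D : 'I_2 -> R) (adv : budget_adversary R 'I_2 'I_2),
      is_pmf D /\
      (forall t : nat, (1 <= t <= T)%N ->
         expectation_budget_adversary pb D adv alg fb
           (@budget_at R 'I_2 'I_2 t) T = (t%:R / 2)%:E) /\
      ((T%:R / 4)%:E <=
         expectation_budget_adversary pb D adv alg fb (regret pb) T)%E).
Proof.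
split.
  have [i regret_i] := alternating_regret R alg fb T.
  exists (target_bandit R i), _, _, (half_budget R), (alternating_adversary R).
  by split=> [t tT|]; rewrite expectation_half_budget// alternating_budget.
have [i regret_i] := matching_regret R alg fb T.
exists (target_bandit R i), (fair_context R), (matching_adversary R).
split; first exact: fair_context_pmf.
by split=> // t tT; exact: matching_budget_mean.
Qed.
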